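(* Let $0<\alpha<1$, let $r\in\mathbb{N}$ and $k_1,k_2,\dots,k_r\in\mathbb{N}$ with $k_1\le k_2\le\cdots\le k_r$ and $k_p^{1-\alpha}>2$ for $p=1,2,\dots,r$, and let $f\in C_B(\mathbb{R})$. Then the following hold. (i) $$\|A_{k_r}(A_{k_{r-1}}(\cdots A_{k_2}(A_{k_1}f)))-f\|_\infty\le\sum_{p=1}^r\|A_{k_p}f-f\|_\infty\le\sum_{p=1}^r\left[\omega\!\left(f,\frac1{k_p^\alpha}\right)+\frac{2\left(q+\frac1q\right)\|f\|_\infty}{B^{\beta(k_p^{1-\alpha}-1)}}\right]\le r\left[\omega\!\left(f,\frac1{k_1^\alpha}\right)+\frac{2\left(q+\frac1q\right)\|f\|_\infty}{B^{\beta(k_1^{1-\alpha}-1)}}\right].$$ (ii) $$\|A^*_{k_r}(A^*_{k_{r-1}}(\cdots A^*_{k_2}(A^*_{k_1}f)))-f\|_\infty\le\sum_{p=1}^r\|A^*_{k_p}f-f\|_\infty\le\sum_{p=1}^r\left[\omega\!\left(f,\frac1{k_p}+\frac1{k_p^\alpha}\right)+\frac{2\left(q+\frac1q\right)\|f\|_\infty}{B^{\beta(k_p^{1-\alpha}-1)}}\right]\le r\left[\omega\!\left(f,\frac1{k_1}+\frac1{k_1^\alpha}\right)+\frac{2\left(q+\frac1q\right)\|f\|_\infty}{B^{\beta(k_1^{1-\alpha}-1)}}\right].$$ (iii) $$\|\overline{A}_{k_r}(\overline{A}_{k_{r-1}}(\cdots \overline{A}_{k_2}(\overline{A}_{k_1}f)))-f\|_\infty\le\sum_{p=1}^r\|\overline{A}_{k_p}f-f\|_\infty\le\sum_{p=1}^r\left[\omega\!\left(f,\frac1{k_p}+\frac1{k_p^\alpha}\right)+\frac{2\left(q+\frac1q\right)\|f\|_\infty}{B^{\beta(k_p^{1-\alpha}-1)}}\right]\le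 r\left[\omega\!\left(f,\frac1{k_1}+\frac1{k_1^\alpha}\right)+\frac{2\left(q+\frac1q\right)\|f\|_\infty}{B^{\beta(k_1^{1-\alpha}-1)}}\right].$$
   Context: Fix real parameters $q>0$, $\beta>0$, $B>1$; $\mathbb{N}=\{1,2,3,\dots\}$. For $x\in\mathbb{R}$ and any $p>0$ put $$\nu_{p,\beta}(x)=\frac{1}{1+pB^{-\beta x}},\qquad G_{p,\beta}(x)=\tfrac12\big(\nu_{p,\beta}(x+1)-\nu_{p,\beta}(x-1)\big),\qquad \Psi(x)=\tfrac12\big(G_{q,\beta}(x)+G_{1/q,\beta}(x)\big).$$ $C_B(\mathbb{R})$ is the set of continuous bounded functions $f:\mathbb{R}\to\mathbb{R}$; $\|\cdot\|_\infty$ is the supremum norm on $\mathbb{R}$. The modulus of continuity is $\omega(f,\theta)=\sup\{|f(x)-f(y)|: x,y\in\mathbb{R},\ |x-y|\le\theta\}$ for $\theta>0$. Fix $\rho\in\mathbb{N}$ and weights $w_1,\dots,w_\rho\ge0$ with $\sum_{j=1}^\rho w_j=1$. For $n\in\mathbb{N}$ and $f\in C_B(\mathbb{R})$ define $$A_n(f)(x)=\int_{-\infty}^{\infty} f\!\left(\frac{v}{n}\right)\Psi(nx-v)\,dv,$$ $$A_n^*(f)(x)=n\int_{-\infty}^{\infty}\left(\int_{v/n}^{(v+1)/n} f(h)\,dh\right)\Psi(nx-v)\,dv,$$ $$\overline{A}_n(f)(x)=\int_{-\infty}^{\infty}\left(\sum_{j=1}^\rho w_j\, f\!\left(\frac vn+\frac{j}{n\rho}\right)\right)\Psi(nx-v)\,dv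 .$$ Each of these maps $C_B(\mathbb{R})$ into itself, so the compositions above are defined. *)

(* Defs.v *)
(* Setting: MathComp-Analysis, over an abstract [R : realType]. *)
From HB Require Export structures.
From mathcomp Require Export all_boot all_order all_algebra.
From mathcomp Require Export all_classical all_reals all_analysis.

Set Implicit Arguments.
Unset Strict Implicit.
Unset Printing Implicit Defensive.

Import Order.TTheory GRing.Theory Num.Theory.
Export numFieldNormedType.Exports.

Local Open Scope classical_set_scope.
Local Open Scope ring_scope.

Definition nu (R : realType) (B p beta x : R) : R :=
  1 / (1 + p * B `^ (- beta * x)).

Definition G (R : realType) (B p beta x : R) : R :=
  2^-1 * (nu B p beta (x + 1) - nu B p beta (x - 1)).

Definition Psi (R : realType) (B q beta x : R) : R :=
  2^-1 * (G B q beta x + G B (1 / q) beta x).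

Definition CB (R : realType) : set (R -> R) :=
  [set f | continuous f /\ bounded_fun f].

(* The suprema below are taken in the extended reals: their values are then the
   true suprema, with no default value for unbounded sets. *)
Definition sup_norm (R : realType) (f : R -> R) : \bar R :=
  ereal_sup [set `|f x|%:E | x in [set: R]].

Definition modulus (R : realType) (f : R -> R) (theta : R) : \bar R :=
  ereal_sup [set `|f xy.1 - f xy.2|%:E |
             xy in [set xy : R * R | `|xy.1 - xy.2| <= theta]].

(* The integrals are real-valued Lebesgue integrals, over the whole line or over
   a compact interval; for [n] positive and [f] in [CB R] all the integrands are
   integrable. *)
Definition A_op (R : realType) (B q beta : R) (n : nat) (f : R -> R) : R -> R :=
  fun x => \int[lebesgue_measure]_(v in [set: R])
    (f (v / n%:R) * Psi B q beta (n%:R * x - v)).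

Definition Astar_op (R : realType) (B q beta : R) (n : nat) (f : R -> R)
    : R -> R :=
  fun x => n%:R * \int[lebesgue_measure]_(v in [set: R])
    ((\int[lebesgue_measure]_(h in `[v / n%:R, (v + 1) / n%:R]) f h)
     * Psi B q beta (n%:R * x - v)).

(* The weights are [w 1], ..., [w rho]; other values of [w] are not used. *)
Definition Abar_op (R : realType) (B q beta : R) (rho : nat) (w : nat -> R)
    (n : nat) (f : R -> R) : R -> R :=
  fun x => \int[lebesgue_measure]_(v in [set: R])
    ((\sum_(1 <= j < rho.+1) w j * f (v / n%:R + j%:R / (n%:R * rho%:R)))
     * Psi B q beta (n%:R * x - v)).

(* [compose_ops L k r f] is L_{k_r} (L_{k_{r-1}} ( ... (L_{k_1} f))). *)
Definition compose_ops (R : realType) (L : nat -> (R -> R) -> (R -> R))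
    (k : nat -> nat) (r : nat) (f : R -> R) : R -> R :=
  iteri r (fun i g => L (k i.+1) g) f.

(* 2 (q + 1/q) ||f|| / B^(beta (n^(1 - alpha) - 1)) *)
Definition tail_term (R : realType) (B q beta alpha : R) (f : R -> R) (n : nat)
    : \bar R :=
  ((2 * (q + 1 / q))%:E * sup_norm f
   * ((B `^ (beta * (n%:R `^ (1 - alpha) - 1)))^-1)%:E)%E.

(* Main.v *)
(** Each operator has the form [T_n = A_n o L_n], where [L_n] averages a function
over a window to the right of the point: [L_n g = g] for [A_n], the Steklov
mean over [[y, y + 1/n]] for [A_n^*], and a weighted mean of the values at
[y + j/(n rho)] for the third family.  The kernel [v |-> Psi (n x - v)] is a
probability density, so every [T_n] is linear and contracts the supremum norm;
telescoping [T_r ... T_1 f - f] then gives the first inequality.  For the second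
one, split the integral at [|n x - v| = N] with [N = n^(1 - alpha)]: the inner
part is controlled by the modulus of continuity, and the outer part by
[2 ||f||] times the two tails of [Psi].  These two tails
are equal, [Psi] being even, and explicit: with [b = beta ln B], the function
[x + ln (1 + p e^(- b x)) / b] is a primitive of [nu].  The third inequality is
monotonicity in [n]. *)

Require Import Defs.
From mathcomp Require Import measurable_realfun ring lra.
Import Order.TTheory GRing.Theory Num.Theory.

Set Implicit Arguments.
Unset Strict Implicit.
Unset Printing Implicit Defensive.

Local Open Scope classical_set_scope.
Local Open Scope ring_scope.

(** * The kernel *)

(** Writing B^(beta x) as e^(b x) with b = beta ln B reduces everything to [expR] and [ln]. *)
Definition rate (R : realType) (B beta : R) : R := beta * ln B.

Lemma rate_gt0 (R : realType) (B beta : R) : 0 < beta -> 1 < B -> 0 < rate B beta.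
Proof. by move=> hb hB; rewrite mulr_gt0// ln_gt0. Qed.

Lemma powR_rate (R : realType) (B beta x : R) : 1 < B ->
  B `^ (beta * x) = expR (rate B beta * x).
Proof.
by move=> hB; rewrite /powR gt_eqF ?(lt_trans ltr01)// /rate mulrAC.
Qed.

Lemma nuE (R : realType) (B p beta x : R) : 1 < B ->
  nu B p beta x = (1 + p * expR (- (rate B beta * x)))^-1.
Proof. by move=> hB; rewrite /nu div1r mulNr -mulrN powR_rate// mulrN. Qed.

Lemma denominator_gt0 (R : realType) (p x : R) : 0 < p -> 0 < 1 + p * expR x.
Proof. by move=> p0; rewrite addr_gt0// mulr_gt0// expR_gt0. Qed.

(** Over a common denominator the constant terms of the numerator cancel. What remains is a product,
    so that sign and growth can be read off factor by factor. *)
Lemma GE (R : realType) (B p beta x : R) : 0 < p -> 1 < B ->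
  let b := rate B beta in
  G B p beta x = 2^-1 * p * (expR b - expR (- b)) * expR (- (b * x)) /
    ((1 + p * expR (- (b * (x + 1)))) * (1 + p * expR (- (b * (x - 1))))).
Proof.
move=> p0 hB b; rewrite /G !nuE// -/b.
have h1 := lt0r_neq0 (denominator_gt0 (- (b * (x + 1))) p0).
have h2 := lt0r_neq0 (denominator_gt0 (- (b * (x - 1))) p0).
have e1 : expR (- (b * (x + 1))) = expR (- b) * expR (- (b * x)).
  by rewrite -expRD; congr expR; ring.
have e2 : expR (- (b * (x - 1))) = expR b * expR (- (b * x)).
  by rewrite -expRD; congr expR; ring.
move: h1 h2; rewrite e1 e2 => h1 h2.
by field; rewrite h1 h2.
Qed.

Lemma G_ge0 (R : realType) (B p beta x : R) : 0 < p -> 0 < beta -> 1 < B ->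
  0 <= G B p beta x.
Proof.
move=> p0 hb hB; rewrite GE// mulr_ge0 ?invr_ge0 ?mulr_ge0 ?expR_ge0 ?invr_ge0//.
- exact: ltW.
- by rewrite subr_ge0 ler_expR ge0_cp// ltW// rate_gt0.
- by rewrite ltW// denominator_gt0.
- by rewrite ltW// denominator_gt0.
Qed.

(** A Harnack-type inequality. The product formula [GE] has three factors depending on x, namely
    e^(- b x) and two reciprocals; a shift by s multiplies each by at most e^(b |s|), whence the 3.
    It serves to prove that the operators preserve continuity. *)
Lemma G_shift_le (R : realType) (B p beta x s : R) :
  0 < p -> 0 < beta -> 1 < B ->
  G B p beta (x + s) <= expR (3 * rate B beta * `|s|) * G B p beta x.
Proof.
move=> p0 hb hB; rewrite !GE//; set b := rate B beta.
have b0 : 0 < b by rewrite rate_gt0.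
have bs : `|b * s| <= b * `|s| by rewrite normrM gtr0_norm.
have [bs1 bs2] : - (b * s) <= b * `|s| /\ b * s <= b * `|s|.
  by move: bs; rewrite ler_norml => /andP[]; split => //; lra.
(* Cross-multiplied, this compares the two summands of the denominators separately, using 1 <= e^(b
   |s|) and b s <= b |s|. *)
have den (y : R) : (1 + p * expR (- (b * (y + s))))^-1 <=
    expR (b * `|s|) * (1 + p * expR (- (b * y)))^-1.
  rewrite -[leLHS]mul1r ler_pdivrMr ?denominator_gt0// mulrAC ler_pdivlMr ?denominator_gt0//.
  rewrite mul1r mulrDr mulr1 lerD//.
    by rewrite -expR0 ler_expR mulr_ge0// ltW.
  rewrite mulrCA ler_wpM2l// ?(ltW p0)// -expRD ler_expR; lra.
have C0 : 0 <= 2^-1 * p * (expR b - expR (- b)).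
  rewrite !mulr_ge0 ?invr_ge0// ?(ltW p0)// subr_ge0 ler_expR; lra.
rewrite !invfM.
have -> : expR (3 * b * `|s|) = expR (b * `|s|) * (expR (b * `|s|) * expR (b * `|s|)).
  by rewrite -!expRD; congr expR; ring.
set X := (1 + p * _)^-1; set Y := (1 + p * _)^-1.
set C := expR b - expR (- b) in C0 *.
set X' := (1 + p * _)^-1; set Y' := (1 + p * _)^-1.
set e := expR (b * `|s|).
have -> : e * (e * e) * (2^-1 * p * C * expR (- (b * x)) * (X' * Y')) =
  2^-1 * p * C * (e * expR (- (b * x))) * ((e * X') * (e * Y')) by ring.
have inv0 (y : R) : 0 <= (1 + p * expR y)^-1 by rewrite invr_ge0 ltW// denominator_gt0.
apply: ler_pM.
- by rewrite (mulr_ge0 C0)// expR_ge0.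
- by rewrite mulr_ge0 ?inv0.
- by rewrite (ler_wpM2l C0)// /e -expRD ler_expR; lra.
apply: ler_pM; [exact: inv0|exact: inv0| |].
- by rewrite /X (_ : x + s + 1 = x + 1 + s)//; ring.
- by rewrite /Y (_ : x + s - 1 = x - 1 + s)//; ring.
Qed.

(** The logistic identity nu_p(- y) = 1 - nu_(1/p)(y), whose constant disappears in the difference.
    Reflection thus exchanges p and 1/p, which makes the symmetrised kernel [Psi] even. *)
Lemma G_opp (R : realType) (B p beta x : R) : 0 < p -> 1 < B ->
  G B p beta (- x) = G B (1 / p) beta x.
Proof.
move=> p0 hB.
have nuN y : nu B p beta (- y) = 1 - nu B (1 / p) beta y.
  rewrite !nuE// mulrN opprK.
  have := denominator_gt0 (rate B beta * y) p0; have := expR_gt0 (rate B beta * y).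
  rewrite expRN; set E := expR _ => E0 D0.
  by field; rewrite !lt0r_neq0 // addrC.
rewrite /G (_ : - x + 1 = - (x - 1)); last by ring.
by rewrite (_ : - x - 1 = - (x + 1)) ?nuN; ring.
Qed.

Lemma G_continuous (R : realType) (B p beta : R) : 0 < p -> 1 < B ->
  continuous (G B p beta).
Proof.
move=> p0 hB.
have cnu : continuous (nu B p beta).
  rewrite (_ : nu B p beta = fun x => (1 + p * expR (- (rate B beta * x)))^-1).
    move=> x; apply: cvgV; first by rewrite lt0r_neq0// denominator_gt0.
    apply: cvgD; first exact: cvg_cst.
    apply: cvgM; first exact: cvg_cst.
    apply: continuous_comp; last exact: continuous_expR.
    by apply: cvgN; apply: cvgM; [exact: cvg_cst|exact: cvg_id].
  by apply/funext => x; rewrite nuE.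
move=> x; apply: cvgM; first exact: cvg_cst.
apply: cvgB.
  apply: continuous_cvg; first exact: cnu.
  by apply: cvgD; [exact: cvg_id|exact: cvg_cst].
apply: continuous_cvg; first exact: cnu.
by apply: cvgB; [exact: cvg_id|exact: cvg_cst].
Qed.

(** * Tails of the kernel *)

Definition softplus (R : realType) (p b x : R) : R := ln (1 + p * expR (- (b * x))).

Lemma is_derive_softplus (R : realType) (p b x : R) : 0 < p ->
  is_derive x 1 (softplus p b) (- b * (1 - (1 + p * expR (- (b * x)))^-1)).
Proof.
move=> p0.
have D0 := denominator_gt0 (- (b * x)) p0.
have h1 : is_derive x 1 (fun y : R => - (b * y)) (- b).
  by apply: is_derive_eq; rewrite /GRing.scale/= mulr1.
have h2 : is_derive x 1 (fun y : R => expR (- (b * y))) (expR (- (b * x)) * (- b)).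
  exact: (@is_derive1_comp _ expR).
have h3 : is_derive x 1 (fun y : R => 1 + p * expR (- (b * y)))
    (p * (expR (- (b * x)) * (- b))).
  by apply: is_derive_eq; rewrite add0r mul1r.
have := @is_derive1_comp _ (@ln R) _ x _ _ (is_derive1_ln D0) h3.
move=> h4; apply: (is_derive_eq h4).
field.
exact: lt0r_neq0.
Qed.

(** The integral of G over [c, +oo[ in closed form: [- Gtail] is the primitive of G that vanishes at
    +oo. *)
Definition Gtail (R : realType) (B beta p c : R) : R :=
  let b := rate B beta in (softplus p b (c - 1) - softplus p b (c + 1)) / (2 * b).

Lemma is_derive_Gtail (R : realType) (B beta p c : R) :
  0 < p -> 0 < beta -> 1 < B ->
  is_derive c 1 (Gtail B beta p) (- G B p beta c).
Proof.
move=> p0 hb hB; have b0 := rate_gt0 hb hB.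
have h s : is_derive c 1 (fun y => softplus p (rate B beta) (y + s))
   (- rate B beta * (1 - nu B p beta (c + s))).
  rewrite nuE//.
  have h1 : is_derive c 1 (fun y : R => y + s) 1.
    by apply: is_derive_eq; rewrite addr0.
  have := @is_derive1_comp _ (softplus p (rate B beta)) (fun y : R => y + s) c _ _
    (is_derive_softplus (rate B beta) _ p0) h1.
  by rewrite mulr1.
have h1 := h 1; have h2 := h (- 1).
have h3 := @is_deriveB _ _ _ _ _ _ _ _ _ h2 h1.
have h4 := @is_deriveZ _ _ _ _ (2 * rate B beta)^-1 _ _ _ h3.
rewrite (_ : Gtail B beta p = (2 * rate B beta)^-1 \*:
    ((fun y => softplus p (rate B beta) (y - 1)) -
     (fun y => softplus p (rate B beta) (y + 1)))); last first.
  by apply/funext => y; rewrite /Gtail mulrC.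
apply: (is_derive_eq h4).
rewrite /GRing.scale/= /G; field.
by rewrite lt0r_neq0.
Qed.

Lemma Gtail_ge0 (R : realType) (B beta p c : R) :
  0 < p -> 0 < beta -> 1 < B -> 0 <= Gtail B beta p c.
Proof.
move=> p0 hb hB; have b0 := rate_gt0 hb hB.
rewrite /Gtail divr_ge0//; last by rewrite mulr_ge0// ltW.
rewrite subr_ge0 ler_ln ?posrE ?denominator_gt0// lerD2l ler_pM2l// ler_expR lerN2.
by rewrite ler_pM2l// lerD2l; lra.
Qed.

(* ln (1 + x) - ln (1 + y) <= x - y for x = p e^(-b(c-1)) and y = p e^(-b(c+1)),
   where x - y = x (1 - e^(-2b)) <= 2 b x. *)
Lemma Gtail_le (R : realType) (B beta p c : R) :
  0 < p -> 0 < beta -> 1 < B ->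
  Gtail B beta p c <= p * expR (- (rate B beta * (c - 1))).
Proof.
move=> p0 hb hB; have b0 := rate_gt0 hb hB.
rewrite /Gtail /softplus; set b := rate B beta in b0 *.
have b20 : 0 < 2 * b by lra.
rewrite (ler_pdivrMr _ _ b20).
have -> : - (b * (c + 1)) = - (b * (c - 1)) + - (2 * b) by ring.
rewrite expRD; set x := expR (- (b * (c - 1))).
have x0 : 0 < x by exact: expR_gt0.
have D1 : 0 < 1 + p * x by rewrite denominator_gt0.
have e1 : 1 - 2 * b <= expR (- (2 * b)) by apply: le_trans (expR_ge1Dx _).
have e2 : expR (- (2 * b)) <= 1 by rewrite expR_le1; lra.
have e3 := expR_gt0 (- (2 * b)).
set y := expR (- (2 * b)) in e1 e2 e3 *.
have px0 : 0 < p * x by rewrite mulr_gt0.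
have D2 : 0 < 1 + p * (x * y) by rewrite addr_gt0// !mulr_gt0.
rewrite -ln_div ?posrE//.
have -> : (1 + p * x) / (1 + p * (x * y)) = 1 + p * x * (1 - y) / (1 + p * (x * y)).
  by field; rewrite lt0r_neq0.
have z0 : 0 <= p * x * (1 - y) by rewrite mulr_ge0 ?(ltW px0)// subr_ge0.
apply: le_trans (le_ln1Dx _) _.
  by rewrite (lt_le_trans (_ : -1 < 0))// ?divr_ge0// ltW.
rewrite ler_pdivrMr//.
apply: (@le_trans _ _ (p * x * (2 * b))).
  by rewrite ler_wpM2l ?(ltW px0)//; lra.
apply: ler_peMr; first by rewrite mulr_ge0 ?ltW// mulr_gt0.
by rewrite lerDl mulrA mulr_ge0// ltW.
Qed.

Lemma Gtail_cvg0 (R : realType) (B beta p : R) :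
  0 < p -> 0 < beta -> 1 < B -> Gtail B beta p c @[c --> +oo] --> (0 : R).
Proof.
move=> p0 hb hB; have b0 := rate_gt0 hb hB.
apply: (squeeze_cvgr (f := cst 0)
    (h := fun c => p * expR (- (rate B beta * (c - 1))))).
- by near=> c; rewrite Gtail_ge0//= Gtail_le.
- exact: cvg_cst.
rewrite -[X in _ --> X](mulr0 p); apply: cvgM; first exact: cvg_cst.
have lin : rate B beta * (c - 1) @[c --> +oo] --> +oo.
  apply/cvgryPge => M; near=> c.
  rewrite -ler_pdivrMl// lerBrDr.
  by near: c; apply: nbhs_pinfty_ge; rewrite num_real.
exact: (cvg_comp _ _ lin (@cvgr_expR R)).
Unshelve. all: by end_near. Qed.

(** * The symmetrised kernel [Psi]: evenness, regularity, mass of its tails *)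

Lemma Psi_ge0 (R : realType) (B q beta x : R) :
  0 < q -> 0 < beta -> 1 < B -> 0 <= Psi B q beta x.
Proof.
move=> q0 hb hB; rewrite /Psi mulr_ge0 ?invr_ge0// addr_ge0// G_ge0//.
by rewrite divr_gt0.
Qed.

Lemma Psi_opp (R : realType) (B q beta x : R) : 0 < q -> 1 < B ->
  Psi B q beta (- x) = Psi B q beta x.
Proof.
move=> q0 hB; rewrite /Psi !G_opp ?divr_gt0//.
by rewrite addrC !div1r invrK.
Qed.

Lemma Psi_shift_le (R : realType) (B q beta x s : R) :
  0 < q -> 0 < beta -> 1 < B ->
  Psi B q beta (x + s) <= expR (3 * rate B beta * `|s|) * Psi B q beta x.
Proof.
move=> q0 hb hB; rewrite /Psi mulrCA ler_wpM2l ?invr_ge0// mulrDr lerD//.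
  exact: G_shift_le.
by apply: G_shift_le; rewrite ?divr_gt0.
Qed.

Lemma Psi_continuous (R : realType) (B q beta : R) : 0 < q -> 1 < B ->
  continuous (Psi B q beta).
Proof.
move=> q0 hB x; apply: cvgM; first exact: cvg_cst.
by apply: cvgD; apply: G_continuous; rewrite ?divr_gt0.
Qed.

Lemma shift_continuous (R : realType) (f : R -> R) (a : R) : continuous f ->
  continuous (fun v => f (v - a)).
Proof.
move=> cf v.
have h : y - a @[y --> v] --> v - a by apply: cvgB; [exact: cvg_id|exact: cvg_cst].
exact: (cvg_comp _ _ h (cf (v - a))).
Qed.

(** The mass of [Psi] on [c, +oo[, which by evenness is also its mass on ]-oo, -c]. *)
Definition Psitail (R : realType) (B q beta c : R) : R :=
  2^-1 * (Gtail B beta q c + Gtail B beta (1 / q) c).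

Lemma is_derive_Psitail (R : realType) (B q beta a v : R) :
  0 < q -> 0 < beta -> 1 < B ->
  is_derive v 1 (fun v => - Psitail B q beta (v - a)) (Psi B q beta (v - a)).
Proof.
move=> q0 hb hB.
have h p : 0 < p ->
    is_derive v 1 (fun y => Gtail B beta p (y - a)) (- G B p beta (v - a)).
  move=> p0.
  have h1 : is_derive v 1 (fun y : R => y - a) 1.
    by apply: is_derive_eq; rewrite ?oppr0 addr0.
  have := @is_derive1_comp _ (Gtail B beta p) (fun y : R => y - a) v _ _
    (is_derive_Gtail _ p0 hb hB) h1.
  by rewrite mulr1.
have q0' : 0 < 1 / q by rewrite divr_gt0.
have h3 := @is_deriveD _ _ _ _ _ _ _ _ _ (h q q0) (h (1 / q) q0').
have h4 := @is_deriveZ _ _ _ _ (- 2^-1) _ _ _ h3.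
rewrite (_ : (fun v => - Psitail B q beta (v - a)) = - 2^-1 \*:
    ((fun y => Gtail B beta q (y - a)) +
     (fun y => Gtail B beta (1 / q) (y - a)))); last first.
  by apply/funext => y; rewrite /Psitail -mulNr.
apply: (is_derive_eq h4).
by rewrite /GRing.scale/= /Psi; ring.
Qed.

Lemma cvg_Psitail (R : realType) (B q beta : R) :
  0 < q -> 0 < beta -> 1 < B -> Psitail B q beta c @[c --> +oo] --> (0 : R).
Proof.
move=> q0 hb hB; rewrite -[X in _ --> X](mulr0 2^-1); apply: cvgM; first exact: cvg_cst.
by rewrite -[X in _ --> X](addr0 0); apply: cvgD; apply: Gtail_cvg0; rewrite ?divr_gt0.
Qed.

(** The two tails cancel the factor 1/2 of [Psi], and the bounds p e^(- b (c - 1)) for p = q and p =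
    1/q add up to the constant q + 1/q of [tail_term]. *)
Lemma Psitail_le (R : realType) (B q beta c : R) :
  0 < q -> 0 < beta -> 1 < B ->
  2 * Psitail B q beta c <= (q + 1 / q) / B `^ (beta * (c - 1)).
Proof.
move=> q0 hb hB; rewrite /Psitail mulrA divff// [leLHS]mul1r mulrDl powR_rate// -expRN.
by rewrite lerD// Gtail_le// divr_gt0.
Qed.

(* For p = q, 1/q the quotients (1 + p e^b) / (1 + p e^-b) have product e^(2b). *)
Lemma Psitail0 (R : realType) (B q beta : R) : 0 < q -> 0 < beta -> 1 < B ->
  2 * Psitail B q beta 0 = 1.
Proof.
move=> q0 hb hB; have b0 := rate_gt0 hb hB.
rewrite /Psitail /Gtail /softplus !sub0r !add0r mulr1 mulrN1 opprK.
rewrite mulrA divff// [LHS]mul1r.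
set b := rate B beta in b0 *.
have q1 : 0 < 1 / q by rewrite divr_gt0.
have d1 := denominator_gt0 b q0; have d2 := denominator_gt0 b q1.
have d3 := denominator_gt0 (- b) q0; have d4 := denominator_gt0 (- b) q1.
have -> : 1 + 1 / q * expR b = expR b * (1 + q * expR (- b)) / q.
  rewrite expRN; field.
  by rewrite !lt0r_neq0// expR_gt0.
have -> : 1 + 1 / q * expR (- b) = expR (- b) * (1 + q * expR b) / q.
  rewrite expRN; field.
  by rewrite !lt0r_neq0// expR_gt0.
rewrite !ln_div ?posrE ?mulr_gt0 ?expR_gt0//.
rewrite !lnM ?posrE ?mulr_gt0 ?expR_gt0// !expRK.
by field; rewrite lt0r_neq0.
Qed.

(** Fundamental theorem of calculus on a half-line: the primitive [F] tends to 0 at +oo, so only its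
    value at a + c contributes. *)
Lemma integral_Psi_right (R : realType) (B q beta a c : R) :
  0 < q -> 0 < beta -> 1 < B ->
  (\int[lebesgue_measure]_(v in `[(a + c)%R, +oo[) (Psi B q beta (v - a))%:E)%E
    = (Psitail B q beta c)%:E.
Proof.
move=> q0 hb hB.
pose F v := - Psitail B q beta (v - a).
have dF (v : R) : is_derive v 1 F (Psi B q beta (v - a)) by exact: is_derive_Psitail.
rewrite (@ge0_continuous_FTC2y _ _ F (a + c) 0).
- by rewrite -EFinB sub0r /F opprK (addrC a) addrK.
- by move=> v _; exact: Psi_ge0.
- apply: continuous_subspaceT.
  exact/shift_continuous/Psi_continuous.
- rewrite -oppr0; apply: cvgN.
  have sh : v - a @[v --> +oo] --> +oo.
    apply/cvgryPge => M; near=> v; rewrite lerBrDr.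
    by near: v; apply: nbhs_pinfty_ge; rewrite num_real.
  exact: (cvg_comp _ _ sh (cvg_Psitail q0 hb hB)).
- by move=> v _; case: (dF v).
- apply: cvg_at_right_filter; apply: differentiable_continuous.
  by apply/derivable1_diffP; case: (dF (a + c)).
- by move=> v _; rewrite derive1E; case: (dF v).
Unshelve. all: by end_near. Qed.

Lemma integral_Psi_left (R : realType) (B q beta a c : R) :
  0 < q -> 0 < beta -> 1 < B ->
  (\int[lebesgue_measure]_(v in `]-oo, (a - c)%R]) (Psi B q beta (v - a))%:E)%E
    = (Psitail B q beta c)%:E.
Proof.
move=> q0 hb hB.
(* The endpoint is put in the form of an opposite so that the substitution v -> - v applies;
   evenness of [Psi] then gives the right tail centred at - a. *)
rewrite -[X in `]-oo, X]]opprK ge0_integration_by_substitutionNy.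
- rewrite opprB (addrC c) -(@integral_Psi_right _ _ _ _ (- a))//.
  apply: eq_integral => v _; rewrite /= -Psi_opp//.
  by congr (Psi _ _ _ _)%:E; ring.
- apply: continuous_subspaceT.
  exact/shift_continuous/Psi_continuous.
- by move=> v _; exact: Psi_ge0.
Qed.

(** * Integrals against the kernel *)

Lemma Psi_sym (R : realType) (B q beta c v : R) : 0 < q -> 1 < B ->
  Psi B q beta (c - v) = Psi B q beta (v - c).
Proof. by move=> q0 hB; rewrite -Psi_opp// opprB. Qed.

Lemma measurable_Psi (R : realType) (B q beta c : R) : 0 < q -> 1 < B ->
  measurable_fun [set: R] (fun v => Psi B q beta (c - v)).
Proof.
move=> q0 hB; apply: continuous_measurable_fun.
under eq_fun do rewrite Psi_sym//.
exact/shift_continuous/Psi_continuous.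
Qed.

(** Cutting the line at the centre c leaves two tails of mass [Psitail 0] each, and [Psitail0] says
    that they sum to 1. *)
Lemma integral_Psi (R : realType) (B q beta c : R) :
  0 < q -> 0 < beta -> 1 < B ->
  (\int[lebesgue_measure]_v (Psi B q beta (c - v))%:E)%E = 1%E.
Proof.
move=> q0 hb hB.
have mP D : measurable D ->
    measurable_fun (D : set R) (EFin \o (fun v => Psi B q beta (c - v))).
  move=> mD; apply/measurable_EFinP/measurable_funTS; exact: measurable_Psi.
rewrite -(setUv `]-oo, c]) setCitvl ge0_integral_setU//=; last 3 first.
- by apply: mP; exact: measurableU.
- by move=> v _; rewrite lee_fin Psi_ge0.
- by rewrite -setCitvl; exact/disj_setPCl.
rewrite integral_itv_obnd_cbnd; last exact: mP.
under eq_integral do rewrite Psi_sym//.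
under [X in (_ + X)%E]eq_integral do rewrite Psi_sym//.
have := integral_Psi_left c 0 q0 hb hB; have := integral_Psi_right c 0 q0 hb hB.
rewrite subr0 addr0 => -> ->.
by rewrite -EFinD -(Psitail0 q0 hb hB); congr _%:E; ring.
Qed.

Lemma integrable_Psi (R : realType) (B q beta c : R) :
  0 < q -> 0 < beta -> 1 < B ->
  lebesgue_measure.-integrable [set: R] (EFin \o (fun v => Psi B q beta (c - v))).
Proof.
move=> q0 hb hB; apply/integrableP; split.
  by apply/measurable_EFinP; exact: measurable_Psi.
under eq_integral do rewrite /= ger0_norm ?Psi_ge0//.
by rewrite integral_Psi// ltey.
Qed.

Lemma Rintegral_Psi (R : realType) (B q beta c : R) :
  0 < q -> 0 < beta -> 1 < B ->
  \int[lebesgue_measure]_(v in [set: R]) Psi B q beta (c - v) = 1.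
Proof. by move=> q0 hb hB; rewrite /Rintegral integral_Psi. Qed.

Lemma bounded_funE (R : realType) (f : R -> R) :
  bounded_fun f <-> exists M, forall x, `|f x| <= M.
Proof.
split=> [[M [_ hM]]|[M hM]].
  by exists (M + 1) => x; apply: (hM (M + 1)) => //; rewrite ltrDl.
exists M; split; first exact: num_real.
by move=> N MN x _ /=; rewrite (le_trans (hM x))// ltW.
Qed.

Lemma integrable_mulPsi (R : realType) (B q beta c : R) (h : R -> R) :
  0 < q -> 0 < beta -> 1 < B -> measurable_fun setT h -> bounded_fun h ->
  lebesgue_measure.-integrable [set: R]
    (EFin \o (fun v => h v * Psi B q beta (c - v))).
Proof.
move=> q0 hb hB mh bh.
have := @integrableMr _ (measurableTypeR R) R lebesgue_measure _ measurableT _ _ mh bh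
  (integrable_Psi c q0 hb hB).
by apply: eq_integrable.
Qed.

Lemma Rintegral_mulPsi_le (R : realType) (B q beta c M : R) (h : R -> R) :
  0 < q -> 0 < beta -> 1 < B -> measurable_fun setT h ->
  (forall v, `|h v| <= M) ->
  `|\int[lebesgue_measure]_(v in [set: R]) (h v * Psi B q beta (c - v))| <= M.
Proof.
move=> q0 hb hB mh bh.
have bh' : bounded_fun h by apply/bounded_funE; exists M.
have ih := integrable_mulPsi c q0 hb hB mh bh'.
apply: (le_trans (le_normr_Rintegral _ ih)) => //.
rewrite -[leRHS]mulr1 -(Rintegral_Psi c q0 hb hB) -RintegralZl//; last exact: integrable_Psi.
apply: le_Rintegral => //.
- exact: integrable_norm.
- have := integrableZl measurableT M (integrable_Psi c q0 hb hB).
  by apply: eq_integrable.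
- by move=> v _; rewrite normrM ler_pM// ger0_norm// Psi_ge0.
Qed.

Lemma integrable_patch (R : realType) (D : set R) (f : R -> R) :
  measurable D -> lebesgue_measure.-integrable [set: R] (EFin \o f) ->
  lebesgue_measure.-integrable [set: R] (EFin \o (f \_ D)).
Proof.
move=> mD fi; rewrite -restrict_EFin; apply/integrable_restrict => //.
by rewrite setTI; apply: integrableS fi.
Qed.

(** The integral is not cut into pieces: |h| K is dominated pointwise by W K plus M times the
    restrictions of K to the two tails. The bound W is charged to the whole line, where K has mass
    1. *)
Lemma Rintegral_mulPsi_tail (R : realType) (B q beta c N W M : R) (h : R -> R) :
  0 < q -> 0 < beta -> 1 < B -> measurable_fun setT h -> 0 <= W ->
  (forall v, `|h v| <= M) -> (forall v, `|v - c| < N -> `|h v| <= W) ->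
  `|\int[lebesgue_measure]_(v in [set: R]) (h v * Psi B q beta (c - v))|
  <= W + M * (2 * Psitail B q beta N).
Proof.
move=> q0 hb hB mh W0 hM hW.
have bh : bounded_fun h by apply/bounded_funE; exists M.
have ih := integrable_mulPsi c q0 hb hB mh bh.
apply: (le_trans (le_normr_Rintegral _ ih)) => //.
pose K v := Psi B q beta (c - v).
have iK : lebesgue_measure.-integrable [set: R] (EFin \o K) by exact: integrable_Psi.
have iZ r (f : R -> R) : lebesgue_measure.-integrable [set: R] (EFin \o f) ->
    lebesgue_measure.-integrable [set: R] (EFin \o (fun v => r * f v)).
  by move=> fi; have := integrableZl measurableT r fi; apply: eq_integrable.
have iD (f g : R -> R) : lebesgue_measure.-integrable [set: R] (EFin \o f) ->
    lebesgue_measure.-integrable [set: R] (EFin \o g) ->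
    lebesgue_measure.-integrable [set: R] (EFin \o (fun v => f v + g v)).
  by move=> fi gi; have := integrableD measurableT fi gi; apply: eq_integrable.
pose E1 := `]-oo, c - N]%classic; pose E2 := `[c + N, +oo[%classic.
have K0 v : 0 <= K v by rewrite Psi_ge0.
have K1 : \int[lebesgue_measure]_(v in [set: R]) (K \_ E1) v = Psitail B q beta N.
  rewrite -Rintegral_mkcond /Rintegral.
  under eq_integral do rewrite /K Psi_sym//.
  by rewrite integral_Psi_left.
have K2 : \int[lebesgue_measure]_(v in [set: R]) (K \_ E2) v = Psitail B q beta N.
  rewrite -Rintegral_mkcond /Rintegral.
  under eq_integral do rewrite /K Psi_sym//.
  by rewrite integral_Psi_right.
have i1 : lebesgue_measure.-integrable [set: R] (EFin \o (K \_ E1)).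
  by apply: integrable_patch => //; exact: measurable_itv.
have i2 : lebesgue_measure.-integrable [set: R] (EFin \o (K \_ E2)).
  by apply: integrable_patch => //; exact: measurable_itv.
have -> : W + M * (2 * Psitail B q beta N) =
   \int[lebesgue_measure]_(v in [set: R]) (W * K v + M * ((K \_ E1) v + (K \_ E2) v)).
  rewrite RintegralD//; [|exact: iZ|exact/iZ/iD].
  rewrite RintegralZl// (Rintegral_Psi c q0 hb hB) RintegralZl//; last exact: iD.
  by rewrite RintegralD// K1 K2; ring.
apply: le_Rintegral => //.
- exact: integrable_norm.
- by apply: (iD); [exact: (iZ)|exact/iZ/iD].
move=> v _; rewrite normrM [X in _ * X <= _]ger0_norm; last exact: K0.
rewrite -/(K v).
have M0 : 0 <= M by apply: le_trans (hM 0).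
have r0 (E : set R) : 0 <= (K \_ E) v by rewrite /patch; case: ifP.
have [vN|Nv] := ltP `|v - c| N.
  rewrite -[leLHS]addr0 lerD//; first by rewrite ler_wpM2r// hW.
  by rewrite mulr_ge0// addr_ge0.
(* Away from the window, v lies in one of the two tails, where the restriction of K equals K. *)
have : K v <= (K \_ E1) v + (K \_ E2) v.
  move: Nv; rewrite ler_normr => /orP[Nv|Nv].
    rewrite -[leLHS]add0r lerD//.
    rewrite /patch ifT// /E2 inE/= in_itv/= andbT; lra.
  rewrite -[leLHS]addr0 lerD//.
  rewrite /patch ifT// /E1 inE/= in_itv/=; lra.
move=> KE; rewrite -[leLHS]add0r lerD//; first by rewrite mulr_ge0.
by apply: ler_pM.
Qed.

(* [Psi (u + s) <= e^(3 b |s|) Psi u] in both directions bounds the increment of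
   the kernel by [(e^(3 b |s|) - 1) Psi u], which is integrable in [u]. *)
Lemma Rintegral_mulPsi_continuous (R : realType) (B q beta : R) (h : R -> R) :
  0 < q -> 0 < beta -> 1 < B -> measurable_fun setT h -> bounded_fun h ->
  continuous (fun c =>
    \int[lebesgue_measure]_(v in [set: R]) (h v * Psi B q beta (c - v))).
Proof.
move=> q0 hb hB mh bh; have [M hM] := (bounded_funE _).1 bh.
have M0 : 0 <= M by apply: le_trans (hM 0).
set I := fun c => _.
pose E (s : R) := expR (3 * rate B beta * `|s|) - 1.
have b0 := rate_gt0 hb hB.
have key c s : `|I (c + s) - I c| <= M * E s.
  have ih a := integrable_mulPsi a q0 hb hB mh bh.
  have iK := integrable_Psi c q0 hb hB.
  rewrite /I -RintegralB//.
  have -> : M * E s = \int[lebesgue_measure]_(v in [set: R]) (M * E s * Psi B q beta (c - v)).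
    by rewrite RintegralZl// Rintegral_Psi// mulr1.
  have iB : lebesgue_measure.-integrable [set: R]
    (EFin \o (fun v => h v * Psi B q beta (c + s - v) - h v * Psi B q beta (c - v))).
    by have := integrableB measurableT (ih (c + s)) (ih c); apply: eq_integrable.
  apply: (le_trans (le_normr_Rintegral _ iB)) => //.
  apply: le_Rintegral => //.
  - exact: integrable_norm.
  - by have := integrableZl measurableT (M * E s) iK; apply: eq_integrable.
  move=> v _; rewrite -mulrBr normrM -mulrA ler_pM//.
  have -> : c + s - v = (c - v) + s by ring.
  have P0 := Psi_ge0 (c - v) q0 hb hB.
  have u := Psi_shift_le (c - v) s q0 hb hB.
  have l := Psi_shift_le (c - v + s) (- s) q0 hb hB.
  rewrite normrN addrK in l.
  rewrite /E; set e := expR _ in u l *.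
  have e1 : 1 <= e by rewrite -expR0 ler_expR mulr_ge0// mulr_ge0// ltW.
  rewrite ler_norml; apply/andP; split; last by lra.
  (* With P and P' the kernel before and after the shift, P <= e P' gives P' >= P / e, and 1 / e >=
     2 - e because (e - 1)^2 >= 0. *)
  nra.
move=> c; apply/cvgrPdist_le => e e0.
have cE : M * E s @[s --> (0 : R)] --> M * E 0.
  apply: cvgM; first exact: cvg_cst.
  apply: cvgB; last exact: cvg_cst.
  apply: continuous_cvg; first exact: continuous_expR.
  apply: cvgM; first exact: cvg_cst.
  exact: norm_continuous.
rewrite /E normr0 mulr0 expR0 subrr mulr0 in cE.
have sc : c' - c @[c' --> c] --> (0 : R).
  by rewrite -[X in _ --> X](subrr c); apply: cvgB; [exact: cvg_id|exact: cvg_cst].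
have /cvgrPdist_le/(_ e e0) H := cvg_comp _ _ sc cE.
near=> c'.
have : `|0 - M * E (c' - c)| <= e by near: c'; exact: H.
rewrite sub0r normrN => He; rewrite distrC.
have := key c (c' - c); rewrite (addrC c) subrK => /le_trans; apply.
exact: le_trans (ler_norm _) He.
Unshelve. all: by end_near. Qed.

(** * Iterated operators *)

Lemma CB_bound (R : realType) (g : R -> R) : CB g -> exists M, forall x, `|g x| <= M.
Proof. by move=> [_ /bounded_funE]. Qed.

Lemma CB_sub (R : realType) (g h : R -> R) : CB g -> CB h -> CB (g \- h).
Proof.
move=> [cg bg] [ch bh]; split; first by move=> x; apply: cvgB; [exact: cg|exact: ch].
have [M hM] := (bounded_funE _).1 bg; have [N hN] := (bounded_funE _).1 bh.
apply/bounded_funE; exists (M + N) => x.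
by rewrite (le_trans (ler_normB _ _))// lerD.
Qed.

Lemma CB_cst (R : realType) (z : R) : CB (cst z : R -> R).
Proof.
split; first exact: cst_continuous.
by apply/bounded_funE; exists `|z|.
Qed.

Lemma scale_continuous (R : realType) (g : R -> R) (a : R) : continuous g ->
  continuous (fun v : R => g (v * a)).
Proof.
move=> cg v.
have h : y * a @[y --> v] --> v * a by apply: cvgM; [exact: cvg_id|exact: cvg_cst].
exact: (cvg_comp _ _ h (cg (v * a))).
Qed.

Lemma CB_scale (R : realType) (g : R -> R) (a : R) : CB g -> CB (fun v : R => g (v * a)).
Proof.
move=> [cg bg]; split; first exact: scale_continuous.
by have [M hM] := (bounded_funE _).1 bg; apply/bounded_funE; exists M.
Qed.

Lemma CB_measurable (R : realType) (g : R -> R) : CB g -> measurable_fun setT g.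
Proof. by move=> [cg _]; exact: continuous_measurable_fun. Qed.

(** * The operator [A_op] on [CB] *)

Lemma A_op_le (R : realType) (B q beta M : R) (n : nat) (g : R -> R) x :
  0 < q -> 0 < beta -> 1 < B -> CB g -> (forall y, `|g y| <= M) ->
  `|A_op B q beta n g x| <= M.
Proof.
move=> q0 hb hB hg hM; apply: Rintegral_mulPsi_le => //.
exact: (CB_measurable (CB_scale _ hg)).
Qed.

Lemma A_op_CB (R : realType) (B q beta : R) (n : nat) (g : R -> R) :
  0 < q -> 0 < beta -> 1 < B -> CB g -> CB (A_op B q beta n g).
Proof.
move=> q0 hb hB hg; have [M hM] := CB_bound hg.
split; last by apply/bounded_funE; exists M => x; exact: A_op_le.
have hn := CB_scale n%:R^-1 hg.
have cI := Rintegral_mulPsi_continuous q0 hb hB (CB_measurable hn) hn.2.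
(* The operator is the continuous function of the centre c just obtained, evaluated at c = n x. *)
rewrite (_ : A_op B q beta n g = fun x =>
  (fun c => \int[lebesgue_measure]_(v in [set: R])
    (g (v * n%:R^-1) * Psi B q beta (c - v))) (x * n%:R)).
  exact: scale_continuous cI.
by apply/funext => x; rewrite /A_op mulrC.
Qed.

Lemma A_op_sub (R : realType) (B q beta : R) (n : nat) (g h : R -> R) x :
  0 < q -> 0 < beta -> 1 < B -> CB g -> CB h ->
  A_op B q beta n (g \- h) x = A_op B q beta n g x - A_op B q beta n h x.
Proof.
move=> q0 hb hB hg hh.
have hg' := CB_scale n%:R^-1 hg; have hh' := CB_scale n%:R^-1 hh.
have ig := integrable_mulPsi (n%:R * x) q0 hb hB (CB_measurable hg') hg'.2.
have ih := integrable_mulPsi (n%:R * x) q0 hb hB (CB_measurable hh') hh'.2.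
rewrite /A_op -RintegralB//.
by apply: eq_Rintegral => v _; rewrite /= mulrBl.
Qed.

Lemma A_op_cst (R : realType) (B q beta z : R) (n : nat) x :
  0 < q -> 0 < beta -> 1 < B -> A_op B q beta n (cst z) x = z.
Proof.
move=> q0 hb hB; rewrite /A_op RintegralZl//; last exact: integrable_Psi.
by rewrite Rintegral_Psi// mulr1.
Qed.

(** Constants are reproduced, so the difference is the operator applied to g - z; distance N in v is
    distance N / n in the argument of g. The number z is arbitrary rather than g x, because g will
    be an average [L n f] compared with f x. *)
Lemma A_op_tail (R : realType) (B q beta N W M z : R) (n : nat) (g : R -> R) x :
  0 < q -> 0 < beta -> 1 < B -> (0 < n)%N -> CB g -> 0 <= W ->
  (forall y, `|g y - z| <= M) ->
  (forall y, `|y - x| < N / n%:R -> `|g y - z| <= W) ->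
  `|A_op B q beta n g x - z| <= W + M * ((q + 1 / q) / B `^ (beta * (N - 1))).
Proof.
move=> q0 hb hB n0 hg W0 hM hW.
have n0' : 0 < n%:R :> R by rewrite ltr0n.
have hz := CB_cst z; have hgz := CB_sub hg hz.
rewrite -[X in _ - X](A_op_cst _ n x q0 hb hB) -A_op_sub//.
have M0 : 0 <= M by apply: le_trans (hM 0).
apply: (@le_trans _ _ (W + M * (2 * Psitail B q beta N))); last first.
  by rewrite lerD2l ler_wpM2l// Psitail_le.
apply: (Rintegral_mulPsi_tail (h := fun v => (g \- cst z) (v / n%:R))) => //.
- exact: (CB_measurable (CB_scale _ hgz)).
- by move=> v; exact: hM.
- move=> v vN; apply: hW.
  rewrite ltr_pdivlMr// -[X in _ * X](gtr0_norm n0') -normrM mulrBl divfK ?gt_eqF//.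
  by rewrite mulrC (mulrC x) in vN *.
Qed.

(** On [CB] the extended supremum is finite. Naming its real value allows the estimates to be
    carried out in R; [CB_modulus] does the same for the modulus. *)
Lemma CB_sup_norm (R : realType) (g : R -> R) : CB g ->
  exists2 S : R, sup_norm g = S%:E & forall x, `|g x| <= S.
Proof.
move=> hg; have [M hM] := CB_bound hg.
have ub x : (`|g x|%:E <= sup_norm g)%E by apply: ereal_sup_ubound; exists x.
have fn : sup_norm g \is a fin_num.
  rewrite fin_numElt (lt_le_trans _ (ub 0)) ?ltNyr//=.
  apply: (@le_lt_trans _ _ M%:E); last exact: ltry.
  by apply: ge_ereal_sup => _ [x _ <-]; rewrite lee_fin.
exists (fine (sup_norm g)); first by rewrite fineK.
by move=> x; rewrite -lee_fin fineK.
Qed.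

Lemma sup_norm_le (R : realType) (g : R -> R) (M : R) :
  (forall x, `|g x| <= M) -> (sup_norm g <= M%:E)%E.
Proof. by move=> hM; apply: ge_ereal_sup => _ [x _ <-]; rewrite lee_fin. Qed.

Lemma CB_modulus (R : realType) (g : R -> R) (t : R) : CB g -> 0 <= t ->
  exists2 W : R, 0 <= W /\ modulus g t = W%:E &
    forall x y, `|x - y| <= t -> `|g x - g y| <= W.
Proof.
move=> hg t0; have [M hM] := CB_bound hg.
have ub x y : `|x - y| <= t -> (`|g x - g y|%:E <= modulus g t)%E.
  by move=> xy; apply: ereal_sup_ubound; exists (x, y).
have ub0 : (0 <= modulus g t)%E.
  by have := ub 0 0; rewrite !subrr normr0; exact.
have fn : modulus g t \is a fin_num.
  rewrite fin_numElt (lt_le_trans _ ub0) ?ltNyr//=.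
  apply: (@le_lt_trans _ _ (M + M)%:E); last exact: ltry.
  apply: ge_ereal_sup => _ [[x y] _ <-]; rewrite lee_fin /=.
  by rewrite (le_trans (ler_normB _ _))// lerD.
exists (fine (modulus g t)); first by rewrite fineK// fine_ge0.
by move=> x y /ub; rewrite -lee_fin fineK.
Qed.

Lemma le_modulus (R : realType) (g : R -> R) (s t : R) : s <= t ->
  (modulus g s <= modulus g t)%E.
Proof.
move=> st; apply: ereal_sup_le => _ [xy h <-]; exists xy => //=.
exact: le_trans h st.
Qed.

(** What the argument requires of the inner averages. [avg_near] says that any closed ball
    containing the values of g on the window also contains the average. With z = 0 it gives
    contraction of the supremum norm, with m = 0 reproduction of constants, and with z = f x the
    comparison with the modulus. *)
Record averaging (R : realType) (L : (R -> R) -> R -> R) (d : R) : Prop := Averaging {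
  avg_width : 0 <= d;
  avg_CB : forall g, CB g -> CB (L g);
  avg_sub : forall g h, CB g -> CB h -> L (g \- h) = L g \- L h;
  avg_near : forall g (y z m : R), CB g ->
    (forall t : R, y <= t <= y + d -> `|g t - z| <= m) -> `|L g y - z| <= m }.

Section iterated.
Context (R : realType) (q beta B : R).
Context (q0 : 0 < q) (hb : 0 < beta) (hB : 1 < B).
Context (L T : nat -> (R -> R) -> R -> R) (d : nat -> R).
Context (avgL : forall n, (0 < n)%N -> averaging (L n) (d n)).
Context (TE : forall n g, (0 < n)%N -> CB g -> T n g = A_op B q beta n (L n g)).

Let T_CB n g : (0 < n)%N -> CB g -> CB (T n g).
Proof.
by move=> n0 hg; rewrite TE//; apply: A_op_CB => //; exact: (avg_CB (avgL n0)).
Qed.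

Let T_sub n g h : (0 < n)%N -> CB g -> CB h -> T n (g \- h) = T n g \- T n h.
Proof.
move=> n0 hg hh; rewrite !TE//; last exact: CB_sub.
apply/funext => x; rewrite (avg_sub (avgL n0))//.
by apply: A_op_sub => //; exact: (avg_CB (avgL n0)).
Qed.

Let T_le n g (M x : R) : (0 < n)%N -> CB g -> (forall y, `|g y| <= M) -> `|T n g x| <= M.
Proof.
move=> n0 hg hM; rewrite TE//; apply: A_op_le => //.
  exact: (avg_CB (avgL n0)).
move=> y; rewrite -[L n g y]subr0; apply: (avg_near (avgL n0)) => // t _.
by rewrite subr0.
Qed.

Lemma compose_ops_CB k r f : (forall p, (1 <= p <= r)%N -> (0 < k p)%N) -> CB f ->
  CB (compose_ops T k r f).
Proof.
move=> kpos hf; elim: r kpos => [//|r IH] kpos.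
have kr : (0 < k r.+1)%N by apply: kpos; rewrite /= leqnn.
apply: (T_CB kr (IH _)) => p /andP[p1 pr].
by apply: kpos; rewrite p1 leqW.
Qed.

Lemma sup_norm_compose_ops k r f :
  (forall p, (1 <= p <= r)%N -> (0 < k p)%N) -> CB f ->
  (sup_norm (compose_ops T k r f \- f)%R <=
    \sum_(1 <= p < r.+1) sup_norm (T (k p) f \- f)%R)%E.
Proof.
move=> kpos hf; elim: r kpos => [|r IH] kpos.
  rewrite big_geq//; apply: sup_norm_le => x.
  by rewrite /compose_ops /= subrr normr0.
have kpos' p : (1 <= p <= r)%N -> (0 < k p)%N.
  by move=> /andP[p1 pr]; apply: kpos; rewrite p1 leqW.
have k0 : (0 < k r.+1)%N by apply: kpos; rewrite /= leqnn.
rewrite big_nat_recr//=.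
have hc := compose_ops_CB kpos' hf.
set g := compose_ops T k r f in hc IH.
have [S1 E1 hS1] := CB_sup_norm (CB_sub hc hf).
have [S2 E2 hS2] := CB_sup_norm (CB_sub (T_CB k0 hf) hf).
apply: (le_trans _ (leeD (IH kpos') (lexx _))).
rewrite E1 E2 -EFinD; apply: sup_norm_le => x.
(* By linearity the new error splits in two. Contraction bounds the first term by the previous
   error, which the induction hypothesis controls; the second is the new summand. *)
have -> : (compose_ops T k r.+1 f \- f) x =
    T (k r.+1) (g \- f) x + (T (k r.+1) f \- f) x.
  by rewrite T_sub//= /compose_ops /= -/g; ring.
rewrite (le_trans (ler_normD _ _))// lerD//.
by apply: T_le => //; exact: CB_sub.
Qed.

(** [A_op_tail] with N = n^(1 - alpha), z = f x and M = 2 ||f||. Since N / n = n^(- alpha), a window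
    of width [d n] starting within N / n of x stays within d n + n^(- alpha) of x. *)
Lemma sup_norm_tail alpha n f : (0 < n)%N -> CB f ->
  (sup_norm (T n f \- f)%R <=
    modulus f (d n + 1 / n%:R `^ alpha)%R + tail_term B q beta alpha f n)%E.
Proof.
move=> n0 hf.
have avg := avgL n0.
have n0' : 0 < n%:R :> R by rewrite ltr0n.
have [S E hS] := CB_sup_norm hf.
have t0 : 0 <= d n + 1 / n%:R `^ alpha.
  by rewrite addr_ge0 ?(avg_width avg)// divr_ge0// powR_ge0.
have [W [W0 EW] hW] := CB_modulus hf t0.
rewrite /tail_term E EW -!EFinM -EFinD; apply: sup_norm_le => x.
have -> : W + 2 * (q + 1 / q) * S / B `^ (beta * (n%:R `^ (1 - alpha) - 1)) =
  W + (2 * S) * ((q + 1 / q) / B `^ (beta * (n%:R `^ (1 - alpha) - 1))).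
  by congr (_ + _); rewrite !mulrA; congr (_ / _); rewrite mulrAC.
rewrite /= TE//; apply: A_op_tail => //; first exact: (avg_CB avg).
- move=> y; apply: (avg_near avg) => // t _.
  by rewrite (le_trans (ler_normB _ _))// mulr_natl mulr2n lerD.
- move=> y hy; apply: (avg_near avg) => // t /andP[t1 t2]; apply: hW.
  have e : n%:R `^ (1 - alpha) / n%:R = 1 / n%:R `^ alpha.
    rewrite powRB; last by rewrite (gt_eqF n0') implybT.
    by rewrite powRr1 ?ltW// mulrAC divff ?gt_eqF.
  rewrite e in hy.
  have := avg_width avg; move: hy; rewrite ltr_norml ler_norml => /andP[h1 h2] h3.
  by apply/andP; split; lra.
Qed.

Lemma iterated_approximation alpha k r f : 0 < alpha < 1 ->
  (forall m n, (0 < m)%N -> (m <= n)%N -> d n <= d m) ->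
  (0 < r)%N -> (forall p, (1 <= p <= r)%N -> (0 < k p)%N) ->
  (forall p, (1 <= p < r)%N -> (k p <= k p.+1)%N) -> CB f ->
  [/\ (sup_norm (compose_ops T k r f \- f)%R
          <= \sum_(1 <= p < r.+1) sup_norm (T (k p) f \- f)%R)%E,
      (\sum_(1 <= p < r.+1) sup_norm (T (k p) f \- f)%R
          <= \sum_(1 <= p < r.+1)
               (modulus f (d (k p) + 1 / (k p)%:R `^ alpha)%R
                + tail_term B q beta alpha f (k p)))%E
    & (\sum_(1 <= p < r.+1)
               (modulus f (d (k p) + 1 / (k p)%:R `^ alpha)%R
                + tail_term B q beta alpha f (k p))
          <= r%:R%:E * (modulus f (d (k 1%N) + 1 / (k 1%N)%:R `^ alpha)%R
                        + tail_term B q beta alpha f (k 1%N)))%E].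
Proof.
move=> /andP[a0 a1] dmono r0 kpos kmono hf; split.
- exact: sup_norm_compose_ops.
- rewrite big_nat [leRHS]big_nat; apply: lee_sum => p hp.
  by apply: sup_norm_tail => //; exact: kpos.
have k1 : (0 < k 1)%N by exact: kpos.
have [S E hS] := CB_sup_norm hf.
have S0 : 0 <= S by apply: le_trans (hS 0).
have t0 : 0 <= d (k 1) + 1 / (k 1)%:R `^ alpha.
  by rewrite addr_ge0 ?(avg_width (avgL k1))// divr_ge0// powR_ge0.
have [W [_ EW] _] := CB_modulus hf t0.
(* Monotonicity between neighbours is chained from index 1. *)
have k1p p : (1 <= p <= r)%N -> (k 1 <= k p)%N.
  case: p => // p; elim: p => // p IH /andP[_ pr].
  by apply: (leq_trans (IH (ltnW pr))); exact: kmono.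
(* Both terms being finite, the multiple by r is a sum of r equal terms, so the inequality can be
   proved term by term. *)
have -> : (r%:R%:E * (modulus f (d (k 1%N) + 1 / (k 1%N)%:R `^ alpha)%R
                        + tail_term B q beta alpha f (k 1%N)) =
   \sum_(1 <= p < r.+1) (modulus f (d (k 1%N) + 1 / (k 1%N)%:R `^ alpha)%R
                        + tail_term B q beta alpha f (k 1%N)))%E.
  rewrite /tail_term EW E -!EFinM -EFinD sumEFin; congr _%:E.
  by rewrite big_const_nat iter_addr_0 subn1 mulr_natl.
rewrite [leLHS]big_nat [leRHS]big_nat; apply: lee_sum => p hp; have kp := k1p p hp.
have kk : (k 1)%:R <= (k p)%:R :> R by rewrite ler_nat.
have k1' : 0 < (k 1)%:R :> R by rewrite ltr0n.
have kp' : 0 < (k p)%:R :> R by exact: lt_le_trans kk.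
(* As n grows the radius shrinks, hence so does the modulus; the exponent of B grows because 1 -
   alpha > 0, hence the tail shrinks because B > 1. *)
apply: leeD.
  apply: le_modulus; rewrite lerD ?dmono// !div1r lef_pV2 ?posrE ?powR_gt0//.
  by rewrite ge0_ler_powR ?nnegrE// ltW.
rewrite /tail_term E -!EFinM lee_fin ler_wpM2l//.
  by rewrite mulr_ge0// mulr_ge0// ltW// addr_gt0// divr_gt0.
have B0 : 0 < B by exact: lt_trans hB.
rewrite lef_pV2 ?posrE ?powR_gt0//; apply: ler_powR; first exact: ltW.
rewrite ler_pM2l// lerD2r; apply: ge0_ler_powR => //; first by rewrite subr_ge0 ltW.
- by rewrite nnegrE ltW.
- by rewrite nnegrE ltW.
Qed.

End iterated.

(** * The three averages *)

Lemma continuous_integrable_itv (R : realType) (g : R -> R) (a b : R) :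
  continuous g -> lebesgue_measure.-integrable `[a, b] (EFin \o g).
Proof.
move=> cg; apply: continuous_compact_integrable; first exact: segment_compact.
exact: continuous_subspaceT.
Qed.

Lemma Rintegral_itv_cst (R : realType) (a b z : R) : a <= b ->
  \int[lebesgue_measure]_(_ in `[a, b]) z = z * (b - a).
Proof.
move=> ab; rewrite Rintegral_cst//= lebesgue_measure_itv/= lte_fin.
case: ltP => [_|ba]; first by rewrite -EFinB.
by rewrite (@le_anti _ _ a b) ?ab// subrr.
Qed.

(** With a fixed base point l, the integral over the moving window is I (y + c) - I y, and the
    primitive I is continuous. *)
Lemma sliding_integral_continuous (R : realType) (g : R -> R) (c : R) :
  0 <= c -> continuous g ->
  continuous (fun y => \int[lebesgue_measure]_(t in `[y, y + c]) g t).
Proof.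
move=> c0 cg x.
(* The margin 1 puts both x and x + c in the interior of [l, u], where continuity within the segment
   is ordinary continuity. *)
pose l := x - 1; pose u := x + c + 1.
pose I y := \int[lebesgue_measure]_(t in `[l, y]) g t.
have lu : l < u by rewrite /l /u; lra.
have cI y : l < y < u -> {for y, continuous I}.
  move=> yI; apply: (within_continuous_continuous lu) => //.
  apply: parameterized_integral_continuous; first exact: ltW.
  exact: continuous_integrable_itv.
have lxu : l < x < u by rewrite /l /u; lra.
have lxcu : l < x + c < u by rewrite /l /u; lra.
have E y : l < y -> \int[lebesgue_measure]_(t in `[y, y + c]) g t = I (y + c) - I y.
  move=> ly; have := @Rintegral_itvB R g (BLeft l) (BRight (y + c)) y
    (continuous_integrable_itv l (y + c) cg).
  rewrite !bnd_simp lerDl (ltW ly) => /(_ isT c0) ->.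
  rewrite Rintegral_itv_obnd_cbnd//.
  apply: integrableS (continuous_integrable_itv y (y + c) cg) => //.
  by apply: subset_itvr; rewrite bnd_simp.
have lim : I (y + c) - I y @[y --> x] --> I (x + c) - I x.
  apply: cvgB; last exact: cI.
  have sh : y + c @[y --> x] --> x + c by apply: cvgD; [exact: cvg_id|exact: cvg_cst].
  exact: (cvg_comp _ _ sh (cI _ lxcu)).
rewrite /continuous_at E; last by case/andP: lxu.
apply: cvg_trans lim; apply: near_eq_cvg; near=> y.
by rewrite E//; near: y; apply: lt_nbhsr; case/andP: lxu.
Unshelve. all: by end_near. Qed.

Lemma averaging_id (R : realType) : averaging (@id (R -> R)) 0.
Proof.
split=> // g y z m _ h; apply: h.
by rewrite addr0 lexx.
Qed.

Definition steklov (R : realType) (n : nat) (g : R -> R) (y : R) : R :=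
  n%:R * \int[lebesgue_measure]_(t in `[y, y + n%:R^-1]) g t.

(** The window has length 1/n, so the factor n normalises its measure: subtracting z commutes with
    the mean, and |g - z| <= m integrates to at most m / n. Boundedness is the case z = 0. *)
Lemma averaging_steklov (R : realType) (n : nat) : (0 < n)%N ->
  averaging (@steklov R n) (1 / n%:R).
Proof.
move=> n0; have n0' : 0 < n%:R :> R by rewrite ltr0n.
have near g (y z m : R) : CB g ->
    (forall t, y <= t <= y + 1 / n%:R -> `|g t - z| <= m) ->
    `|steklov n g y - z| <= m.
  move=> hg h; rewrite div1r in h.
  have yn : y <= y + n%:R^-1 by rewrite lerDl invr_ge0 ltW.
  have hgz := CB_sub hg (CB_cst z).
  have ig := continuous_integrable_itv y (y + n%:R^-1) hg.1.
  have iz := continuous_integrable_itv y (y + n%:R^-1) (CB_cst z).1.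
  have igz := continuous_integrable_itv y (y + n%:R^-1) hgz.1.
  have im := continuous_integrable_itv y (y + n%:R^-1) (CB_cst m).1.
  have -> : steklov n g y - z =
      n%:R * \int[lebesgue_measure]_(t in `[y, y + n%:R^-1]) (g \- cst z) t.
    rewrite RintegralB//= Rintegral_itv_cst// addrAC subrr add0r.
    by rewrite /steklov mulrBr mulrCA divff ?mulr1// gt_eqF.
  rewrite normrM gtr0_norm// -ler_pdivlMl// mulrC.
  rewrite (le_trans (le_normr_Rintegral _ igz))//.
  have -> : m / n%:R = \int[lebesgue_measure]_(_ in `[y, y + n%:R^-1]) m.
    by rewrite Rintegral_itv_cst// addrAC subrr add0r.
  by apply: le_Rintegral => //; exact: integrable_norm.
split=> //.
- move=> g hg; split.
    move=> y; apply: cvgM; first exact: cvg_cst.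
    by apply: sliding_integral_continuous; [rewrite invr_ge0 ltW|exact: hg.1].
  have [M hM] := CB_bound hg; apply/bounded_funE; exists M => y.
  by rewrite -[X in `|X|]subr0; apply: near => // t _; rewrite subr0.
- move=> g h hg hh; apply/funext => y; rewrite /steklov /= RintegralB ?mulrBr//.
    exact: continuous_integrable_itv hg.1.
  exact: continuous_integrable_itv hh.1.
Qed.

(** Since (v + 1) / n = v / n + 1 / n, the inner integral is 1/n times the Steklov mean at v / n;
    this 1/n leaves the outer integral and cancels the prefactor. *)
Lemma Astar_opE (R : realType) (B q beta : R) n (g : R -> R) :
  0 < q -> 0 < beta -> 1 < B -> (0 < n)%N -> CB g ->
  Astar_op B q beta n g = A_op B q beta n (steklov n g).
Proof.
move=> q0 hb hB n0 hg; apply/funext => x.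
have n0' : n%:R != 0 :> R by rewrite pnatr_eq0 -lt0n.
have hs := CB_scale n%:R^-1 (avg_CB (averaging_steklov R n0) hg).
have iS := integrable_mulPsi (n%:R * x) q0 hb hB (CB_measurable hs) hs.2.
have -> : Astar_op B q beta n g x = n%:R * \int[lebesgue_measure]_(v in [set: R])
    (n%:R^-1 * (steklov n g (v / n%:R) * Psi B q beta (n%:R * x - v))).
  congr (_ * _); apply: eq_Rintegral => v _.
  by rewrite /steklov -(mulrA n%:R) mulKf// mulrDl mul1r.
by rewrite RintegralZl// mulrA divff// mul1r.
Qed.

Definition weighted_mean (R : realType) (rho : nat) (w : nat -> R) (n : nat)
    (g : R -> R) (y : R) : R :=
  \sum_(1 <= j < rho.+1) w j * g (y + j%:R / (n%:R * rho%:R)).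

(** A convex combination of values of g at nodes in the window: j / (n rho) <= 1 / n because j <=
    rho. *)
Lemma averaging_weighted_mean (R : realType) (rho : nat) (w : nat -> R) (n : nat) :
  (0 < rho)%N -> (forall j : nat, (1 <= j <= rho)%N -> 0 <= w j) ->
  \sum_(1 <= j < rho.+1) w j = 1 -> (0 < n)%N ->
  averaging (weighted_mean rho w n) (1 / n%:R).
Proof.
move=> rho0 w0 w1 n0.
have n0' : 0 < n%:R :> R by rewrite ltr0n.
have rho0' : 0 < rho%:R :> R by rewrite ltr0n.
have near g (y z m : R) : CB g ->
    (forall t, y <= t <= y + 1 / n%:R -> `|g t - z| <= m) ->
    `|weighted_mean rho w n g y - z| <= m.
  move=> hg h.
  (* The weights sum to 1, so z and m are spread over the nodes and compared termwise. *)
  have mE c : c = \sum_(1 <= j < rho.+1) w j * c by rewrite -mulr_suml w1 mul1r.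
  rewrite [z in _ - z]mE /weighted_mean -sumrB.
  rewrite (le_trans (ler_norm_sum _ _ _))// [leRHS]mE.
  rewrite big_nat [leRHS]big_nat; apply: ler_sum => j hj.
  rewrite -mulrBr normrM ger0_norm ?w0// ler_wpM2l ?w0//; apply: h.
  rewrite lerDl divr_ge0//= ?mulr_ge0 ?(ltW n0') ?(ltW rho0')//.
  rewrite lerD2l div1r invfM mulrCA -[leRHS]mulr1 ler_wpM2l ?invr_ge0 ?(ltW n0')//.
  by rewrite ler_pdivrMr// mul1r ler_nat; case/andP: hj.
split=> //.
- move=> g hg; split; last first.
    have [M hM] := CB_bound hg; apply/bounded_funE; exists M => y.
    by rewrite -[X in `|X|]subr0; apply: near => // t _; rewrite subr0.
  move=> y; apply: cvg_big => [|j _]; first exact: add_continuous.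
  apply: cvgM; first exact: cvg_cst.
  have sh : y' + j%:R / (n%:R * rho%:R) @[y' --> y] --> y + j%:R / (n%:R * rho%:R).
    by apply: cvgD; [exact: cvg_id|exact: cvg_cst].
  exact: (cvg_comp _ _ sh (hg.1 _)).
- move=> g h hg hh; apply/funext => y; rewrite /weighted_mean /= -sumrB.
  by apply: eq_bigr => j _; rewrite mulrBr.
Qed.

(** * The three families as instances of the iterated estimate *)

Theorem theorem15 (R : realType) (q beta B : R)
    (hq : 0 < q) (hbeta : 0 < beta) (hB : 1 < B)
    (rho : nat) (hrho : (0 < rho)%N) (w : nat -> R)
    (hw0 : forall j : nat, (1 <= j <= rho)%N -> 0 <= w j)
    (hw1 : \sum_(1 <= j < rho.+1) w j = 1)
    (alpha : R) (halpha : 0 < alpha < 1)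
    (r : nat) (hr : (0 < r)%N) (k : nat -> nat)
    (hkpos : forall p : nat, (1 <= p <= r)%N -> (0 < k p)%N)
    (hkmono : forall p : nat, (1 <= p < r)%N -> (k p <= k p.+1)%N)
    (hkbig : forall p : nat, (1 <= p <= r)%N -> 2 < (k p)%:R `^ (1 - alpha))
    (f : R -> R) (hf : CB f) :
  let A := A_op B q beta in
  let As := Astar_op B q beta in
  let Ab := Abar_op B q beta rho w in
  let tail := tail_term B q beta alpha f in
  [/\ (* (i) *)
    [/\ (sup_norm (compose_ops A k r f \- f)%R
          <= \sum_(1 <= p < r.+1) sup_norm (A (k p) f \- f)%R)%E,
        (\sum_(1 <= p < r.+1) sup_norm (A (k p) f \- f)%R
          <= \sum_(1 <= p < r.+1)
               (modulus f (1 / (k p)%:R `^ alpha)%R + tail (k p)))%E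
      & (\sum_(1 <= p < r.+1)
               (modulus f (1 / (k p)%:R `^ alpha)%R + tail (k p))
          <= r%:R%:E * (modulus f (1 / (k 1%N)%:R `^ alpha)%R + tail (k 1%N)))%E],
    (* (ii) *)
    [/\ (sup_norm (compose_ops As k r f \- f)%R
          <= \sum_(1 <= p < r.+1) sup_norm (As (k p) f \- f)%R)%E,
        (\sum_(1 <= p < r.+1) sup_norm (As (k p) f \- f)%R
          <= \sum_(1 <= p < r.+1)
               (modulus f (1 / (k p)%:R + 1 / (k p)%:R `^ alpha)%R
                + tail (k p)))%E
      & (\sum_(1 <= p < r.+1)
               (modulus f (1 / (k p)%:R + 1 / (k p)%:R `^ alpha)%R
                + tail (k p))
          <= r%:R%:E * (modulus f (1 / (k 1%N)%:R + 1 / (k 1%N)%:R `^ alpha)%R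
                        + tail (k 1%N)))%E]
    & (* (iii) *)
    [/\ (sup_norm (compose_ops Ab k r f \- f)%R
          <= \sum_(1 <= p < r.+1) sup_norm (Ab (k p) f \- f)%R)%E,
        (\sum_(1 <= p < r.+1) sup_norm (Ab (k p) f \- f)%R
          <= \sum_(1 <= p < r.+1)
               (modulus f (1 / (k p)%:R + 1 / (k p)%:R `^ alpha)%R
                + tail (k p)))%E
      & (\sum_(1 <= p < r.+1)
               (modulus f (1 / (k p)%:R + 1 / (k p)%:R `^ alpha)%R
                + tail (k p))
          <= r%:R%:E * (modulus f (1 / (k 1%N)%:R + 1 / (k 1%N)%:R `^ alpha)%R
                        + tail (k 1%N)))%E]].
Proof.
move=> A As Ab tail.
have inv_mono m n : (0 < m)%N -> (m <= n)%N -> 1 / n%:R <= 1 / m%:R :> R.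
  move=> m0 mn; have n0 := leq_trans m0 mn.
  by rewrite !div1r lef_pV2 ?posrE ?ltr0n// ler_nat.
split.
(* Here the inner average is the identity with window width 0, so the radius appears as 0 + 1 /
   n^alpha and the 0 has to be removed. *)
- have [h1 h2 h3] := @iterated_approximation R q beta B hq hbeta hB (fun=> id) A
    (fun=> 0) (fun n _ => averaging_id R) (fun n g _ _ => erefl) alpha k r f halpha
    (fun _ _ _ _ => lexx _) hr hkpos hkmono hf.
  have sumE : (\sum_(1 <= p < r.+1) (modulus f (1 / (k p)%:R `^ alpha)%R + tail (k p)) =
      \sum_(1 <= p < r.+1) (modulus f (0 + 1 / (k p)%:R `^ alpha)%R + tail (k p)))%E.
    by apply: eq_bigr => p _; rewrite add0r.
  by split; [exact: h1|rewrite sumE; exact: h2|rewrite sumE -[X in modulus f X]add0r].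
- exact: (@iterated_approximation R q beta B hq hbeta hB (@steklov R) As _
    (fun n => @averaging_steklov R n) (fun n g => Astar_opE hq hbeta hB)
    alpha k r f halpha inv_mono hr hkpos hkmono hf).
(* The factorisation through [weighted_mean] holds by conversion. *)
- exact: (@iterated_approximation R q beta B hq hbeta hB (weighted_mean rho w) Ab _
    (fun n => averaging_weighted_mean hrho hw0 hw1)
    (fun n g _ _ => erefl) alpha k r f halpha inv_mono hr hkpos hkmono hf).
Qed.
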